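(* Let $\{t_n\}_{n\in\mathbb{N}}$ be a sequence of pairwise distinct complex numbers such that $\lim_{n\to\infty}|t_n|=\infty$, $$\sum_{n=1}^{\infty}\frac{1}{|t_n|}<+\infty\qquad\text{and}\qquad \sum_{n=1}^{\infty}\frac{1}{t_n}\neq 0 .$$ Then the meromorphic function $f(z)=\sum_{k=1}^{\infty}\frac{1}{z-t_k}$ has at least one zero in $\mathbb{C}$.
   Context: Under the convergence hypothesis (which in particular presupposes $t_n\neq 0$ for all $n$), the series defining $f$ converges absolutely and uniformly on compact subsets of $\mathbb{C}\setminus\{t_n\}_{n\in\mathbb{N}}$ and defines a meromorphic function in $\mathbb{C}$. *)

(* Defs.v *)
(* Stdlib's real numbers and Coquelicot's complex numbers. *)
From Stdlib Require Import Reals.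
From Coquelicot Require Import Coquelicot.

Definition csum (a : nat -> C) (s : C) : Prop :=
  @is_series C_AbsRing C_NormedModule a s.

(* [pole_sum t z w]: f(z) = w, where f(z) = sum_k 1 / (z - t_k).  [Cinv] is
   total, so the graph of f is restricted explicitly to the complement of the
   poles t_k, which is where f is holomorphic. *)
Definition pole_sum (t : nat -> C) (z w : C) : Prop :=
  (forall k : nat, z <> t k) /\ csum (fun k : nat => / (z - t k))%C w.

(* Main.v *)
(** Suppose [f] has no zero, and let [P_n(z) = prod_(k < n) (1 - z / t_k)]. Off the poles
    [P_n' = P_n * sum_(k < n) 1 / (z - t_k)], so on every disc [P_n'] is bounded away from [0]
    for [n] large. As [sum 1 / |t_k|] converges, [|P_n'(z)| <= C exp (eps |z|)] for every
    [eps > 0], with [C] independent of [n]. For a zero-free [F = P_n'] with [ln |F| < B] on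
    [|z| <= R], the Ahlfors-Schwarz argument (the maximum principle for
    [|F'/F| (R^2 - |z|^2) / (B - ln |F|)]) gives
    [|F'/F| (R^2 - |z|^2) <= 2 R (B - ln |F|)]. Letting [R] grow, with [B] of order [eps R],
    [P_n''] tends to [0] uniformly on compact sets. Hence [P_n] is nearly affine with a
    non-zero slope, which contradicts [P_n(t_0) = P_n(t_1) = 0]. *)
Require Import Defs.
From Stdlib Require Import Reals Lra Lia Psatz Classical ClassicalEpsilon.
From Coquelicot Require Import Coquelicot.
Local Open Scope R_scope.

(** * Compactness of closed discs *)

Lemma sqrt2_lt_2 : sqrt 2 < 2.
Proof. rewrite <- (sqrt_square 2) at 2 by lra. apply sqrt_lt_1; lra. Qed.

(** A Lebesgue-number form of compactness. The single parameter [d] measures both the neighbourhood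
    and the quality of the property, so a positive lower bound for the gauge given by [loc] yields
    one [d] for the whole disc. That bound comes from [compactness_value_2d] on the square around
    the disc. *)
Lemma disc_compact (R0 : R) (P : R -> C -> Prop)
  (mono : forall d e w, 0 < d <= e -> P e w -> P d w)
  (loc : forall z, Cmod z <= R0 -> exists d, 0 < d /\
     forall w, Cmod w <= R0 -> Cmod (w - z) < d -> P d w) :
  exists d, 0 < d /\ forall w, Cmod w <= R0 -> P d w.
Proof.
  (* The gauge must be defined on all of the square. At points outside the disc, the radius chosen
     makes the condition vacuous. The factor 2 absorbs the [sqrt 2] between the max norm and
     [Cmod]. *)
  assert (loc' : forall z : C, exists d : posreal,
    forall w, Cmod w <= R0 -> Cmod (w - z) < 2 * d -> P d w).
  { intros z. destruct (Rle_dec (Cmod z) R0) as [hz|hz].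
    - destruct (loc z hz) as (d & hd & H).
      assert (hd2 : 0 < d / 2) by lra.
      exists (mkposreal _ hd2); simpl. intros w hw hwz.
      apply mono with d; [lra|]. apply H; auto; lra.
    - assert (hd : 0 < (Cmod z - R0) / 2) by lra.
      exists (mkposreal _ hd); simpl. intros w hw hwz. exfalso.
      assert (T := Cmod_triangle w (- (w - z))).
      rewrite Cmod_opp in T. replace (w + - (w - z))%C with z in T by ring. lra. }
  set (delta := fun u v => proj1_sig
     (constructive_indefinite_description _ (loc' (u, v)))).
  assert (hdelta : forall u v w, Cmod w <= R0 -> Cmod (w - (u, v)) < 2 * delta u v ->
     P (delta u v) w).
  { intros u v. unfold delta.
    destruct (constructive_indefinite_description _ (loc' (u, v))); auto. }
  destruct (compactness_value_2d (- R0) R0 (- R0) R0 delta) as [d hd].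
  (* [compactness_value_2d] yields its tag [(u, v)] only under a double negation. *)
  exists d. split; [apply cond_pos|]. intros w hw. apply NNPP. intros nP.
  assert (M := Rmax_Cmod w).
  assert (M1 := Rmax_l (Rabs (fst w)) (Rabs (snd w))).
  assert (M2 := Rmax_r (Rabs (fst w)) (Rabs (snd w))).
  refine (hd (fst w) (snd w) _ _ _).
  - apply Rabs_le_between; lra.
  - apply Rabs_le_between; lra.
  - intros (u & v & _ & _ & h1 & h2 & h3). apply nP.
    apply mono with (delta u v); [split; [apply cond_pos|exact h3]|].
    apply hdelta; auto.
    eapply Rle_lt_trans; [apply Cmod_2Rmax|]. simpl.
    assert (hs := sqrt2_lt_2).
    assert (hx : Rmax (Rabs (fst w + - u)) (Rabs (snd w + - v)) < delta u v)
      by (apply Rmax_lub_lt; assumption).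
    assert (hp := cond_pos (delta u v)).
    assert (hs0 := sqrt_pos 2).
    assert (hm := Rle_trans _ _ _ (Rabs_pos (fst w + - u))
                     (Rmax_l (Rabs (fst w + - u)) (Rabs (snd w + - v)))).
    unfold Rminus in *. nra.
Qed.

(** [disc_compact] is applied twice: with [f w <= / d] for boundedness, then, if the supremum [m] is
    not attained, with [f w <= m - d], which would push the supremum below [m]. *)
Lemma disc_max (R0 : R) (f : C -> R) (hR : 0 <= R0)
  (cont : forall z, Cmod z <= R0 -> continuous f z) :
  exists z, Cmod z <= R0 /\ forall w, Cmod w <= R0 -> f w <= f z.
Proof.
  assert (usc : forall z eps, Cmod z <= R0 -> 0 < eps -> exists d, 0 < d /\
    forall w, Cmod (w - z) < d -> f w < f z + eps).
  { intros z eps hz he. specialize (cont z hz).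
    destruct (proj1 (filterlim_locally f (f z)) cont (mkposreal eps he)) as [d hd].
    exists d. split; [apply cond_pos|]. intros w hw.
    specialize (hd w (C_NormedModule_mixin_compat1 _ _ _ hw)).
    apply Rabs_def2 in hd. simpl in hd. unfold minus, plus, opp in hd; simpl in hd. lra. }
  destruct (disc_compact R0 (fun d w => f w <= / d)) as (d & hd & bd).
  { intros d e w hde h. apply Rle_trans with (1 := h). apply Rinv_le_contravar; lra. }
  { intros z hz. destruct (usc z 1 hz Rlt_0_1) as (d & hd & h).
    assert (hp : 0 < / (Rabs (f z) + 1)).
    { apply Rinv_0_lt_compat. assert (h' := Rabs_pos (f z)). lra. }
    exists (Rmin d (/ (Rabs (f z) + 1))). split; [apply Rmin_pos; auto|].
    intros w _ hw. specialize (h w (Rlt_le_trans _ _ _ hw (Rmin_l _ _))).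
    apply Rle_trans with (Rabs (f z) + 1); [assert (h' := Rle_abs (f z)); lra|].
    rewrite <- (Rinv_inv (Rabs (f z) + 1)) at 1.
    apply Rinv_le_contravar; [apply Rmin_pos; auto|apply Rmin_r]. }
  destruct (completeness (fun y => exists w, Cmod w <= R0 /\ y = f w)) as [m [ub lub]].
  { exists (/ d). intros y (w & hw & ->). auto. }
  { exists (f 0). exists (RtoC 0). rewrite Cmod_0. auto. }
  apply NNPP. intros no.
  assert (lt : forall z, Cmod z <= R0 -> f z < m).
  { intros z hz. apply Rnot_le_lt. intros hm. apply no. exists z. split; auto.
    intros w hw. apply Rle_trans with m; auto. apply ub. exists w; auto. }
  destruct (disc_compact R0 (fun d w => f w <= m - d)) as (e & he & be).
  { intros d1 d2 w h1 h2. lra. }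
  { intros z hz. specialize (lt z hz).
    assert (hp : 0 < (m - f z) / 2) by lra.
    destruct (usc z _ hz hp) as (d1 & hd1 & h).
    exists (Rmin d1 ((m - f z) / 2)). split; [apply Rmin_pos; auto|].
    intros w _ hw. specialize (h w (Rlt_le_trans _ _ _ hw (Rmin_l _ _))).
    assert (h' := Rmin_r d1 ((m - f z) / 2)). lra. }
  assert (m <= m - e); [|lra].
  apply lub. intros y (w & hw & ->). auto.
Qed.

(** * Second derivatives of real functions at 0 *)

(* [f'(0) = f1] and [f''(0) = f2]. *)
Definition jet (f : R -> R) (f1 f2 : R) : Prop :=
  exists g, locally 0 (fun x => is_derive f x (g x)) /\ g 0 = f1 /\ is_derive g 0 f2.

(** If [f2 > 0], the derivative [g] has slope above [f2 / 2] near 0. On the right when [g 0 >= 0],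
    on the left otherwise, [g] then has a strict sign, and the mean value theorem gives a value of
    [f] above [f 0]. Choosing the side this way avoids proving [g 0 = 0] first. *)
Lemma jet_max (f : R -> R) (f1 f2 : R) :
  jet f f1 f2 -> locally 0 (fun x => f x <= f 0) -> f2 <= 0.
Proof.
  intros (g & [e1 h1] & h0 & hg) [e2 h2].
  apply Rnot_lt_le. intros pos.
  apply is_derive_Reals in hg.
  destruct (hg (f2 / 2)) as [e3 h3]; [lra|].
  set (e := Rmin (Rmin e1 e2) e3 / 2).
  assert (he : 0 < e /\ e < e1 /\ e < e2 /\ e < e3).
  { assert (p1 := cond_pos e1). assert (p2 := cond_pos e2). assert (p3 := cond_pos e3).
    unfold e. assert (m1 := Rmin_l (Rmin e1 e2) e3). assert (m2 := Rmin_r (Rmin e1 e2) e3).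
    assert (m3 := Rmin_l e1 e2). assert (m4 := Rmin_r e1 e2).
    assert (0 < Rmin (Rmin e1 e2) e3) by (repeat apply Rmin_pos; auto). lra. }
  assert (D : forall x, Rabs x < e1 -> derivable_pt_lim f x (g x)).
  { intros x hx. apply is_derive_Reals. apply h1.
    change (Rabs (x - 0) < e1). rewrite Rminus_0_r. exact hx. }
  assert (slope : forall x, x <> 0 -> Rabs x < e3 -> (g x - g 0) / x > f2 / 2).
  { intros x hx hx3. specialize (h3 x hx hx3). rewrite Rplus_0_l in h3.
    apply Rabs_def2 in h3. lra. }
  assert (loc : forall x, Rabs x < e2 -> f x <= f 0).
  { intros x hx. apply h2. change (Rabs (x - 0) < e2). rewrite Rminus_0_r. exact hx. }
  destruct (Rle_dec 0 (g 0)) as [hs|hs].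
  - destruct (MVT_cor2 f g 0 e) as (c & hc & hc1); [lra| |].
    { intros c hc. apply D. rewrite Rabs_pos_eq; lra. }
    assert (s := slope c (Rgt_not_eq _ _ (proj1 hc1))). rewrite Rabs_pos_eq in s by lra.
    specialize (s ltac:(lra)).
    assert (g c - g 0 = (g c - g 0) / c * c) by (field; lra).
    assert (l := loc e). rewrite Rabs_pos_eq in l by lra. specialize (l ltac:(lra)).
    assert (0 < g c) by nra. nra.
  - destruct (MVT_cor2 f g (- e) 0) as (c & hc & hc1); [lra| |].
    { intros c hc. apply D. rewrite Rabs_left1; lra. }
    assert (s := slope c (Rlt_not_eq _ _ (proj2 hc1))). rewrite Rabs_left1 in s by lra.
    specialize (s ltac:(lra)).
    assert (g c - g 0 = (g c - g 0) / c * c) by (field; lra).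
    assert (l := loc (- e)). rewrite Rabs_left1 in l by lra. specialize (l ltac:(lra)).
    assert (g c < 0) by nra. nra.
Qed.

Lemma jet_plus f f1 f2 h h1 h2 :
  jet f f1 f2 -> jet h h1 h2 -> jet (fun x => f x + h x) (f1 + h1) (f2 + h2).
Proof.
  intros (g & A & A0 & A1) (k & B & B0 & B1). exists (fun x => g x + k x).
  split; [|split].
  - eapply filter_imp; [|exact (filter_and _ _ A B)]. intros x [u v].
    apply (is_derive_plus (K:=R_AbsRing) (V:=R_NormedModule)); assumption.
  - congruence.
  - apply (is_derive_plus (K:=R_AbsRing) (V:=R_NormedModule)); assumption.
Qed.

Lemma jet_affine f f1 f2 (a c : R) :
  jet f f1 f2 -> jet (fun x => c + a * f x) (a * f1) (a * f2).
Proof.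
  intros (g & A & A0 & A1). exists (fun x => a * g x). split; [|split].
  - eapply filter_imp; [|exact A]. intros x hx. auto_derive.
    + exists (g x); exact hx.
    + rewrite (is_derive_unique (fun x : R => f x) _ _ hx). ring.
  - congruence.
  - auto_derive.
    + exists f2; exact A1.
    + rewrite (is_derive_unique (fun x : R => g x) _ _ A1). ring.
Qed.

Lemma locally_pos (f : R -> R) (x : R) :
  continuous f x -> 0 < f x -> locally x (fun y => 0 < f y).
Proof.
  intros cont pos. apply (cont (fun y => 0 < y)).
  exists (mkposreal _ pos). intros y hy. apply Rabs_def2 in hy.
  simpl in hy. unfold minus, plus, opp in hy; simpl in hy. lra.
Qed.

Lemma jet_ln f f1 f2 :
  0 < f 0 -> jet f f1 f2 -> jet (fun x => ln (f x)) (f1 / f 0) (f2 / f 0 - (f1 / f 0) ^ 2).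
Proof.
  intros pos (g & A & A0 & A1). exists (fun x => g x / f x).
  assert (D0 : is_derive f 0 (g 0)) by (apply (locally_singleton _ _ A)).
  assert (P : locally 0 (fun x => 0 < f x)).
  { apply locally_pos; [|exact pos].
    apply (@ex_derive_continuous R_AbsRing R_NormedModule). exists (g 0). exact D0. }
  split; [|split].
  - eapply filter_imp; [|exact (filter_and _ _ A P)]. intros x [hx px]. auto_derive.
    + split; [exists (g x); exact hx|auto].
    + rewrite (is_derive_unique (fun x : R => f x) _ _ hx). field. lra.
  - congruence.
  - auto_derive.
    + split; [exists f2; exact A1|split; [exists (g 0); exact D0|split; [lra|auto]]].
    + rewrite (is_derive_unique (fun x : R => g x) _ _ A1), (is_derive_unique (fun x : R => f x) _ _ D0), A0. field. lra.
Qed.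

(** * Holomorphic functions along real lines *)

(* Holomorphy in the weak form that is used: [F1] gives the directional derivatives of the
   real and imaginary parts of [F] along every line. *)
Definition hol (F F1 : C -> C) : Prop := forall (z d : C) (x : R),
  is_derive (fun y : R => Re (F (z + y * d)%C)) x (Re (d * F1 (z + x * d)%C)%C) /\
  is_derive (fun y : R => Im (F (z + y * d)%C)) x (Im (d * F1 (z + x * d)%C)%C).

Lemma hol_const (c : C) : hol (fun _ => c) (fun _ => RtoC 0).
Proof.
  intros z d x. rewrite Cmult_0_r. split; apply (@is_derive_const R_AbsRing R_NormedModule).
Qed.

Lemma hol_id : hol (fun z => z) (fun _ => RtoC 1).
Proof.
  intros z d x. rewrite Cmult_1_r. split; unfold Re, Im; simpl; auto_derive; auto; ring.
Qed.

Lemma hol_plus F F1 G G1 : hol F F1 -> hol G G1 ->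
  hol (fun z => F z + G z)%C (fun z => F1 z + G1 z)%C.
Proof.
  intros HF HG z d x. destruct (HF z d x) as [A B]. destruct (HG z d x) as [A' B'].
  rewrite Cmult_plus_distr_l. split.
  - exact (is_derive_plus (V:=R_NormedModule) _ _ _ _ _ A A').
  - exact (is_derive_plus (V:=R_NormedModule) _ _ _ _ _ B B').
Qed.

Lemma is_derive_Rmult (u v : R -> R) (x l m : R) : is_derive u x l -> is_derive v x m ->
  is_derive (fun y => u y * v y) x (l * v x + u x * m).
Proof. intros hu hv. exact (is_derive_mult (K:=R_AbsRing) u v x l m hu hv Rmult_comm). Qed.

Lemma hol_mult F F1 G G1 : hol F F1 -> hol G G1 ->
  hol (fun z => F z * G z)%C (fun z => F1 z * G z + F z * G1 z)%C.
Proof.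
  intros HF HG z d x. destruct (HF z d x) as [A B]. destruct (HG z d x) as [A' B'].
  split.
  - eapply is_derive_ext with (f := fun y : R =>
      Re (F (z + y * d)%C) * Re (G (z + y * d)%C) - Im (F (z + y * d)%C) * Im (G (z + y * d)%C)).
    { intros y. reflexivity. }
    replace (Re (d * (F1 (z + x * d) * G (z + x * d) + F (z + x * d) * G1 (z + x * d)))%C)
      with (minus (Re (d * F1 (z + x * d))%C * Re (G (z + x * d)%C)
            + Re (F (z + x * d)%C) * Re (d * G1 (z + x * d))%C)
            (Im (d * F1 (z + x * d))%C * Im (G (z + x * d)%C)
            + Im (F (z + x * d)%C) * Im (d * G1 (z + x * d))%C)).
    2: { unfold minus, plus, opp; simpl. unfold Re, Im, Cmult, Cplus; simpl. ring. }
    apply (is_derive_minus (V:=R_NormedModule)); apply is_derive_Rmult; assumption.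
  - eapply is_derive_ext with (f := fun y : R =>
      Re (F (z + y * d)%C) * Im (G (z + y * d)%C) + Im (F (z + y * d)%C) * Re (G (z + y * d)%C)).
    { intros y. reflexivity. }
    replace (Im (d * (F1 (z + x * d) * G (z + x * d) + F (z + x * d) * G1 (z + x * d)))%C)
      with (plus (Re (d * F1 (z + x * d))%C * Im (G (z + x * d)%C)
            + Re (F (z + x * d)%C) * Im (d * G1 (z + x * d))%C)
            (Im (d * F1 (z + x * d))%C * Re (G (z + x * d)%C)
            + Im (F (z + x * d)%C) * Re (d * G1 (z + x * d))%C)).
    2: { unfold plus; simpl. unfold Re, Im, Cmult, Cplus; simpl. ring. }
    apply (is_derive_plus (V:=R_NormedModule)); apply is_derive_Rmult; assumption.
Qed.

(** Squared moduli are polynomial in the coordinates, so they can be differentiated without a square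
    root; [ln_Cmod] leads back to [Cmod]. *)
Definition normsq (z : C) : R := Re z ^ 2 + Im z ^ 2.

Lemma is_derive_value (f : R -> R) (x l m : R) : is_derive f x l -> l = m -> is_derive f x m.
Proof. intros h <-. exact h. Qed.

Lemma normsq_mul (z : C) : normsq z = Re z * Re z + Im z * Im z.
Proof. unfold normsq. ring. Qed.

Lemma is_derive_normsq F F1 (z d : C) (x : R) : hol F F1 ->
  is_derive (fun y : R => normsq (F (z + y * d)%C)) x
    (2 * (Re (F (z + x * d)%C) * Re (d * F1 (z + x * d))%C
          + Im (F (z + x * d)%C) * Im (d * F1 (z + x * d))%C)).
Proof.
  intros H. destruct (H z d x) as [A B].
  apply is_derive_ext with (f := fun y : R =>
    Re (F (z + y * d)%C) * Re (F (z + y * d)%C) + Im (F (z + y * d)%C) * Im (F (z + y * d)%C)).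
  { intros y. symmetry. exact (normsq_mul _). }
  eapply is_derive_value.
  { apply (is_derive_plus (V:=R_NormedModule)); apply is_derive_Rmult; eassumption. }
  match goal with |- @eq _ ?a ?b => change (@eq R a b) end.
  unfold plus; simpl. ring.
Qed.

(** Differentiate Re(F)^2 + Im(F)^2 twice along [d]. The terms in [F2] carry the factor d^2, so they
    cancel when the directions [1] and [Ci] are added; this is what makes ln |F| harmonic. *)
Lemma jet_normsq F F1 F2 (z d : C) : hol F F1 -> hol F1 F2 ->
  jet (fun x : R => normsq (F (z + x * d)%C))
    (2 * (Re (F z) * Re (d * F1 z)%C + Im (F z) * Im (d * F1 z)%C))
    (2 * (normsq (d * F1 z)%C
          + Re (F z) * Re (d * (d * F2 z))%C + Im (F z) * Im (d * (d * F2 z))%C)).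
Proof.
  intros H H1.
  assert (H1' : forall x : R,
     is_derive (fun y : R => Re (d * F1 (z + y * d))%C) x (Re (d * (d * F2 (z + x * d)))%C) /\
     is_derive (fun y : R => Im (d * F1 (z + y * d))%C) x (Im (d * (d * F2 (z + x * d)))%C)).
  { intros x. destruct (hol_mult _ _ _ _ (hol_const d) H1 z d x) as [A B].
    replace (d * (d * F2 (z + x * d)))%C with
      (d * (0 * F1 (z + x * d) + d * F2 (z + x * d)))%C by ring. split; assumption. }
  exists (fun x : R => 2 * (Re (F (z + x * d)%C) * Re (d * F1 (z + x * d))%C
                 + Im (F (z + x * d)%C) * Im (d * F1 (z + x * d))%C)).
  assert (z0 : (z + 0 * d)%C = z) by ring.
  split; [|split].
  - apply filter_forall. intros x. apply is_derive_normsq. exact H.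
  - rewrite z0. reflexivity.
  - destruct (H z d 0) as [A B]. destruct (H1' 0) as [A1 B1].
    eapply is_derive_value.
    { apply is_derive_scal. apply (is_derive_plus (V:=R_NormedModule)); apply is_derive_Rmult; eassumption. }
    unfold plus, normsq; simpl. rewrite z0. ring.
Qed.

Lemma normsq_Cmod z : normsq z = Cmod z ^ 2.
Proof. symmetry. apply Cmod2_alt. Qed.

Lemma normsq_pos z : z <> RtoC 0 -> 0 < normsq z.
Proof. intros h. rewrite normsq_Cmod. apply pow_lt. apply Cmod_gt_0. exact h. Qed.

Lemma ln_Cmod z : z <> RtoC 0 -> ln (Cmod z) = / 2 * ln (normsq z).
Proof.
  intros h. apply Cmod_gt_0 in h. rewrite normsq_Cmod. simpl. rewrite Rmult_1_r.
  rewrite ln_mult by assumption. lra.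
Qed.

Lemma hol_line_nonzero F F1 (z d : C) : hol F F1 -> F z <> RtoC 0 ->
  locally 0 (fun x : R => F (z + x * d)%C <> RtoC 0).
Proof.
  intros H h.
  assert (z0 : (z + 0 * d)%C = z) by ring.
  assert (Cf : continuous (fun x : R => normsq (F (z + x * d)%C)) 0).
  { apply (@ex_derive_continuous R_AbsRing R_NormedModule).
    eexists. apply is_derive_normsq. exact H. }
  assert (pos := normsq_pos _ h). rewrite <- z0 in pos.
  eapply filter_imp; [|exact (locally_pos _ _ Cf pos)]. intros x hx e.
  cbv beta in hx. rewrite e in hx. unfold normsq in hx. simpl in hx. lra.
Qed.

Lemma jet_continuous f f1 f2 : jet f f1 f2 -> continuous f 0.
Proof.
  intros (g & A & _). apply (@ex_derive_continuous R_AbsRing R_NormedModule).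
  exists (g 0). apply (locally_singleton _ _ A).
Qed.

(** * The Ahlfors-Schwarz estimate *)

(** It suffices to bound the quotient [psi] of the two sides (without the factor [2 * R0]) at its
    maximum on the closed disc. Were [psi] above [2 * R0] there, ln [psi] would be twice
    differentiable at that point with positive Laplacian, against the second derivative test. [F3]
    enters because ln |F1| is differentiated twice. *)
Lemma log_deriv_bound (F F1 F2 F3 : C -> C) (R0 B : R) :
  0 < R0 -> hol F F1 -> hol F1 F2 -> hol F2 F3 ->
  (forall z, continuous (fun w => Cmod (F w)) z) ->
  (forall z, continuous (fun w => Cmod (F1 w)) z) ->
  (forall z, Cmod z <= R0 -> F z <> RtoC 0 /\ ln (Cmod (F z)) < B) ->
  forall z, Cmod z <= R0 ->
  Cmod (F1 z) * (R0 ^ 2 - Cmod z ^ 2) <= 2 * R0 * Cmod (F z) * (B - ln (Cmod (F z))).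
Proof.
  intros hR H0 H1 H2 C0 C1 HF.
  set (psi := fun z => Cmod (F1 z) * (R0 ^ 2 - Cmod z ^ 2) / (Cmod (F z) * (B - ln (Cmod (F z))))).
  assert (den : forall z, Cmod z <= R0 -> 0 < Cmod (F z) /\ 0 < B - ln (Cmod (F z))).
  { intros z hz. destruct (HF z hz) as [a b]. split; [apply Cmod_gt_0; auto|lra]. }
  assert (cmod : forall z : C, continuous Cmod z).
  { intros z. exact (@filterlim_norm C_AbsRing C_NormedModule z). }
  destruct (disc_max R0 psi) as (z0 & hz0 & zmax); [lra| |].
  { intros z hz. destruct (den z hz) as [d1 d2].
    assert (Cln : continuous (fun w => B - ln (Cmod (F w))) z).
    { apply (@continuous_minus C_UniformSpace R_AbsRing R_NormedModule (fun _ => B)).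
      - apply continuous_const.
      - apply (@continuous_comp C_UniformSpace R_UniformSpace R_UniformSpace
                 (fun w => Cmod (F w)) ln); [apply C0|apply continuous_ln; exact d1]. }
    apply (@continuous_mult C_UniformSpace R_AbsRing
             (fun w => Cmod (F1 w) * (R0 ^ 2 - Cmod w ^ 2))
             (fun w => / (Cmod (F w) * (B - ln (Cmod (F w)))))).
    - apply (@continuous_mult C_UniformSpace R_AbsRing (fun w => Cmod (F1 w))
               (fun w => R0 ^ 2 - Cmod w ^ 2)); [apply C1|].
      apply (@continuous_minus C_UniformSpace R_AbsRing R_NormedModule (fun _ => R0 ^ 2));
        [apply continuous_const|].
      apply (@continuous_mult C_UniformSpace R_AbsRing Cmod (fun w => Cmod w * 1)); [apply cmod|].
      apply (@continuous_mult C_UniformSpace R_AbsRing Cmod (fun w => 1));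
        [apply cmod|apply continuous_const].
    - apply (@continuous_comp C_UniformSpace R_UniformSpace R_UniformSpace
               (fun w => Cmod (F w) * (B - ln (Cmod (F w)))) Rinv).
      + exact (@continuous_mult C_UniformSpace R_AbsRing _ _ _ (C0 z) Cln).
      + apply continuous_Rinv. apply Rgt_not_eq. apply Rmult_lt_0_compat; assumption. }
  assert (key : psi z0 <= 2 * R0).
  { apply Rnot_lt_le. intros big.
    destruct (den z0 hz0) as [d1 d2].
    assert (dd := Rmult_lt_0_compat _ _ d1 d2).
    assert (big' : 2 * R0 * (Cmod (F z0) * (B - ln (Cmod (F z0)))) <
              Cmod (F1 z0) * (R0 ^ 2 - Cmod z0 ^ 2)).
    { apply (Rmult_lt_compat_r _ _ _ dd) in big. unfold psi, Rdiv in big.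
      rewrite (Rmult_assoc (Cmod (F1 z0) * _)), Rinv_l in big by lra. lra. }
    (* Positivity forces [z0] off the boundary circle and [F1 z0 <> 0], so every logarithm in
       [theta] below has a positive argument at [z0]. *)
    assert (prod : 0 < Cmod (F1 z0) * (R0 ^ 2 - Cmod z0 ^ 2)) by nra.
    assert (m1 := Cmod_ge_0 (F1 z0)). assert (mz := Cmod_ge_0 z0).
    assert (hlt : 0 < R0 ^ 2 - Cmod z0 ^ 2) by nra.
    assert (F1z : F1 z0 <> RtoC 0).
    { intros e. rewrite e, Cmod_0 in prod. lra. }
    assert (Fz : F z0 <> RtoC 0) by (apply Cmod_gt_0; exact d1).
    (* [theta] is [ln psi] in terms of squared moduli. Its Laplacian, the sum of its second
       derivatives along [1] and [Ci], is [|F1/F|^2 / (B - ln |F|)^2 - 4 R0^2 / (R0^2 - |z|^2)^2],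
       because [ln |F|] and [ln |F1|] are harmonic. *)
    set (theta := fun w => 0 + / 2 * ln (normsq (F1 w)) + ln (R0 ^ 2 + (-1) * normsq w)
            + (0 + (- / 2) * ln (normsq (F w)))
            + (0 + (-1) * ln (B + (- / 2) * ln (normsq (F w))))).
    assert (theta_psi : forall w, Cmod w <= R0 -> 0 < R0 ^ 2 + (-1) * normsq w ->
       F1 w <> RtoC 0 -> 0 < psi w /\ theta w = ln (psi w)).
    { intros w hw hr h1. destruct (den w hw) as [e1 e2].
      assert (q1 := proj1 (Cmod_gt_0 _) h1).
      assert (ew : R0 ^ 2 + (-1) * normsq w = R0 ^ 2 - Cmod w ^ 2) by (rewrite normsq_Cmod; ring).
      rewrite ew in hr.
      assert (Fw : F w <> RtoC 0) by (apply Cmod_gt_0; exact e1).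
      assert (ed := Rmult_lt_0_compat _ _ e1 e2). assert (en := Rmult_lt_0_compat _ _ q1 hr).
      split; [unfold psi; apply Rdiv_lt_0_compat; assumption|].
      unfold psi. rewrite ln_div, !ln_mult by assumption.
      unfold theta. rewrite ew.
      replace (B + - / 2 * ln (normsq (F w))) with (B - ln (Cmod (F w)))
        by (rewrite ln_Cmod by assumption; ring).
      rewrite !ln_Cmod by assumption. ring. }
    assert (P0 := normsq_pos _ Fz). assert (P1 := normsq_pos _ F1z).
    assert (Pr : 0 < R0 ^ 2 + (-1) * normsq z0) by (rewrite normsq_Cmod; lra).
    assert (Pw : 0 < B + (- / 2) * ln (normsq (F z0))).
    { rewrite ln_Cmod in d2 by assumption. lra. }
    (* The left side is the second derivative of [theta] along [d], in the shape the jet lemmas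
       produce; [A0] is that of the logarithm of [normsq (F w)]. *)
    assert (second : forall d : C,
      let A0 := 2 * (normsq (d * F1 z0)%C + Re (F z0) * Re (d * (d * F2 z0))%C
                     + Im (F z0) * Im (d * (d * F2 z0))%C) / normsq (F z0) -
            (2 * (Re (F z0) * Re (d * F1 z0)%C + Im (F z0) * Im (d * F1 z0)%C)
             / normsq (F z0)) ^ 2 in
      / 2 * (2 * (normsq (d * F2 z0)%C + Re (F1 z0) * Re (d * (d * F3 z0))%C
                     + Im (F1 z0) * Im (d * (d * F3 z0))%C) / normsq (F1 z0) -
            (2 * (Re (F1 z0) * Re (d * F2 z0)%C + Im (F1 z0) * Im (d * F2 z0)%C)
             / normsq (F1 z0)) ^ 2)
      + (-1 * (2 * (normsq (d * 1)%C + Re z0 * Re (d * (d * 0))%C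
                     + Im z0 * Im (d * (d * 0))%C)) / (R0 ^ 2 + -1 * normsq z0) -
            (-1 * (2 * (Re z0 * Re (d * 1)%C + Im z0 * Im (d * 1)%C))
             / (R0 ^ 2 + -1 * normsq z0)) ^ 2)
      + - / 2 * A0
      + -1 * (- / 2 * A0 / (B + - / 2 * ln (normsq (F z0))) -
         (- / 2 * (2 * (Re (F z0) * Re (d * F1 z0)%C + Im (F z0) * Im (d * F1 z0)%C)
             / normsq (F z0)) / (B + - / 2 * ln (normsq (F z0)))) ^ 2) <= 0).
    { intros d.
      assert (e0 : (z0 + 0 * d)%C = z0) by ring.
      assert (P0' := P0). assert (P1' := P1). assert (Pr' := Pr). assert (Pw' := Pw).
      rewrite <- e0 in P0', P1', Pr', Pw'.
      assert (J0 := jet_ln _ _ _ P0' (jet_normsq _ _ _ z0 d H0 H1)).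
      assert (J1 := jet_ln _ _ _ P1' (jet_normsq _ _ _ z0 d H1 H2)).
      assert (Jrho := jet_affine _ _ _ (-1) (R0 ^ 2)
                      (jet_normsq _ _ _ z0 d hol_id (hol_const 1))).
      assert (Jr := jet_ln _ _ _ Pr' Jrho).
      assert (JW := jet_ln _ _ _ Pw' (jet_affine _ _ _ (- / 2) B J0)).
      assert (J := jet_plus _ _ _ _ _ _ (jet_plus _ _ _ _ _ _ (jet_plus _ _ _ _ _ _
         (jet_affine _ _ _ (/ 2) 0 J1) Jr)
         (jet_affine _ _ _ (- / 2) 0 J0)) (jet_affine _ _ _ (-1) 0 JW)).
      cbv beta in J. rewrite !e0 in J.
      apply jet_max in J; [exact J|].
      assert (Lr := locally_pos _ _ (jet_continuous _ _ _ Jrho) Pr').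
      eapply filter_imp;
        [|exact (filter_and _ _ Lr (hol_line_nonzero _ _ z0 d H1 F1z))].
      intros x [hr h1]. cbv beta in hr.
      (* The summands of [theta] have the shape [c + a * f x] of [jet_affine], which makes [theta]
         on the line convertible to the function treated by [J]. *)
      change (theta (z0 + x * d)%C <= theta (z0 + 0 * d)%C). rewrite e0.
      assert (hx : Cmod (z0 + x * d)%C <= R0).
      { rewrite normsq_Cmod in hr. assert (mx := Cmod_ge_0 (z0 + x * d)%C). nra. }
      destruct (theta_psi _ hx hr h1) as [p1 ->].
      destruct (theta_psi _ hz0 Pr F1z) as [p2 ->].
      destruct (Rle_lt_or_eq_dec _ _ (zmax _ hx)) as [l|l].
      - left. apply ln_increasing; assumption.
      - right. rewrite l. reflexivity. }
    assert (S1 := second 1%C). assert (S2 := second Ci). cbv zeta in S1, S2.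
    clear second.
    rewrite ln_Cmod in big' by assumption.
    set (W := B + - / 2 * ln (normsq (F z0))) in *.
    replace (B - / 2 * ln (normsq (F z0))) with W in big' by (unfold W; ring).
    clearbody W.
    replace (Cmod z0 ^ 2) with (normsq z0) in big' by apply normsq_Cmod.
    set (rho := R0 ^ 2 + -1 * normsq z0) in *.
    replace (R0 ^ 2 - normsq z0) with rho in big' by (unfold rho; ring).
    (* In the sum of [S1] and [S2] all terms in [F2 z0] and [F3 z0] cancel. With [R0 ^ 2] written as
       [rho + normsq z0], this is a rational identity in the coordinates. *)
    assert (main : normsq (F1 z0) / (normsq (F z0) * W ^ 2) - 4 * R0 ^ 2 / rho ^ 2 <= 0).
    { assert (Erho : R0 ^ 2 = rho + normsq z0) by (unfold rho; ring).
      rewrite Erho. clearbody rho. unfold normsq in *.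
      generalize (Rplus_le_compat _ _ _ _ S1 S2).
      unfold Re, Im in *; simpl.
      destruct (F z0) as [a b], (F1 z0) as [a1 b1], (F2 z0) as [a2 b2], (F3 z0) as [a3 b3].
      destruct z0 as [p q]. simpl in *.
      match goal with |- ?x <= _ -> ?y <= _ => replace x with y; [lra|] end.
      field. lra. }
    rewrite !normsq_Cmod in main.
    set (m0 := Cmod (F z0)) in *. set (n1 := Cmod (F1 z0)) in *.
    assert (hW : 0 < m0 * W) by (apply Rmult_lt_0_compat; assumption).
    assert (sq : (2 * R0 * (m0 * W)) ^ 2 < (n1 * rho) ^ 2).
    { assert (px : 0 < 2 * R0 * (m0 * W)) by (apply Rmult_lt_0_compat; lra).
      clear - px big'. nra. }
    assert (cl : (n1 ^ 2 / (m0 ^ 2 * W ^ 2) - 4 * R0 ^ 2 / rho ^ 2) * (m0 * W * rho) ^ 2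
              = (n1 * rho) ^ 2 - (2 * R0 * (m0 * W)) ^ 2) by (field; lra).
    assert (H : 0 < (m0 * W * rho) ^ 2) by (apply pow_lt, Rmult_lt_0_compat; assumption).
    assert (le0 := Rmult_le_compat_r _ _ _ (Rlt_le _ _ H) main). lra. }
  intros z hz. destruct (den z hz) as [d1 d2].
  assert (le := Rle_trans _ _ _ (zmax z hz) key). unfold psi in le.
  assert (dd := Rmult_lt_0_compat _ _ d1 d2).
  apply (Rmult_le_compat_r _ _ _ (Rlt_le _ _ dd)) in le.
  unfold Rdiv in le. rewrite Rmult_assoc, Rinv_l in le by lra. lra.
Qed.

(** * The mean value inequality *)

Lemma hol_ext F F1 G G1 : (forall z, F z = G z) -> (forall z, F1 z = G1 z) ->
  hol F F1 -> hol G G1.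
Proof.
  intros e e1 H z d x. destruct (H z d x) as [A B]. rewrite <- e1. split.
  - eapply is_derive_ext; [|exact A]. intros y. cbv beta. rewrite e. reflexivity.
  - eapply is_derive_ext; [|exact B]. intros y. cbv beta. rewrite e. reflexivity.
Qed.

(** The real mean value theorem applies to the projection of [F] on the direction [c = F b - F a]
    along the segment from [a] to [b], which stays in the disc by convexity. The increment of this
    projection is |c|^2, so one factor |c| can be cancelled unless [c = 0]. *)
Lemma hol_lipschitz F F1 (R0 L : R) (a b : C) : hol F F1 ->
  (forall w, Cmod w <= R0 -> Cmod (F1 w) <= L) -> Cmod a <= R0 -> Cmod b <= R0 ->
  Cmod (F b - F a) <= L * Cmod (b - a).
Proof.
  intros H bd ha hb.
  set (c := (F b - F a)%C).
  set (g := fun x : R => Re c * Re (F (a + x * (b - a))%C) + Im c * Im (F (a + x * (b - a))%C)).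
  set (g' := fun x : R => Re c * Re ((b - a) * F1 (a + x * (b - a)))%C
                   + Im c * Im ((b - a) * F1 (a + x * (b - a)))%C).
  destruct (MVT_cor2 g g' 0 1 Rlt_0_1) as (x & hx & hx01).
  { intros x _. apply is_derive_Reals. destruct (H a (b - a)%C x) as [A B].
    apply (is_derive_plus (V:=R_NormedModule)); apply is_derive_scal; assumption. }
  assert (g01 : g 1 - g 0 = Cmod c ^ 2).
  { unfold g. replace (a + 1 * (b - a))%C with b by ring.
    replace (a + 0 * (b - a))%C with a by ring. rewrite Cmod2_alt.
    unfold c, Re, Im; simpl. ring. }
  assert (hw : Cmod (a + x * (b - a))%C <= R0).
  { replace (a + x * (b - a))%C with ((1 - x)%R * a + x * b)%C
      by (rewrite RtoC_minus; ring).
    eapply Rle_trans; [apply Cmod_triangle|]. rewrite !Cmod_mult, !Cmod_R.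
    rewrite !Rabs_pos_eq by lra. nra. }
  assert (le1 : g' x <= Cmod c * (Cmod (b - a) * L)).
  { apply Rle_trans with (Cmod (Cconj c * ((b - a) * F1 (a + x * (b - a))))%C).
    - eapply Rle_trans; [|apply re_le_Cmod]. eapply Rle_trans; [|apply Rle_abs].
      right. unfold g', Re, Im; simpl. ring.
    - rewrite !Cmod_mult, Cmod_conj.
      apply Rmult_le_compat_l; [apply Cmod_ge_0|].
      apply Rmult_le_compat_l; [apply Cmod_ge_0|]. auto. }
  rewrite g01 in hx.
  destruct (Cmod_ge_0 c) as [pc|pc].
  - apply Rmult_le_reg_l with (Cmod c); [exact pc|]. lra.
  - rewrite <- pc. apply Rle_trans with (0 * Cmod (b - a)); [lra|].
    apply Rmult_le_compat_r; [apply Cmod_ge_0|].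
    apply Rle_trans with (2 := bd _ hw). apply Cmod_ge_0.
Qed.

(** * Derivatives of the partial products and their growth *)

(* The [j]-th derivative of [prod_(k < n) (1 - u k * z)]. *)
Fixpoint dprod (u : nat -> C) (j n : nat) (z : C) : C :=
  match n with
  | O => match j with O => RtoC 1 | S _ => RtoC 0 end
  | S m => (dprod u j m z * (1 - u m * z) -
      match j with O => RtoC 0 | S i => INR j * u m * dprod u i m z end)%C
  end.

(** Each new factor is affine, so the Leibniz rule keeps only two terms, and the coefficient of the
    second grows by one per differentiation. *)
Lemma hol_dprod u n j : hol (dprod u j n) (dprod u (S j) n).
Proof.
  revert j. induction n as [|n IH]; intros j.
  - destruct j; apply (hol_const _).
  - assert (L : hol (fun z => 1 + - u n * z)%C (fun _ => - u n)%C).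
    { eapply (hol_ext (fun z => 1 + - u n * z)%C (fun z => 0 + (0 * z + - u n * 1))%C);
        [| |apply hol_plus; [apply hol_const|apply hol_mult; [apply hol_const|apply hol_id]]];
        intros z; cbv beta; ring. }
    assert (HM := hol_mult _ _ _ _ (IH j) L).
    destruct j as [|j].
    + eapply hol_ext; [| |exact HM]; intros z; simpl; ring.
    + assert (HM2 := hol_mult _ _ _ _ (hol_const (- (INR (S j) * u n))%C) (IH j)).
      eapply hol_ext; [| |exact (hol_plus _ _ _ _ HM HM2)]; intros z.
      * cbn [dprod]. ring.
      * cbn [dprod]. rewrite (S_INR (S j)), RtoC_plus. ring.
Qed.

(** Starts from the empty sum, whereas [sum_n a n] has [n + 1] terms. *)
Fixpoint psum (a : nat -> R) (n : nat) : R :=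
  match n with O => 0 | S m => psum a m + a m end.

(** The majorant of |prod (1 - u_k z)| for |u_k| = a_k and |z| = x. *)
Fixpoint pprod (a : nat -> R) (x : R) (n : nat) : R :=
  match n with O => 1 | S m => pprod a x m * (1 + x * a m) end.

Lemma psum_ge_0 a n : (forall k, 0 <= a k) -> 0 <= psum a n.
Proof. intros h. induction n; simpl; [lra|]. specialize (h n). lra. Qed.

Lemma psum_mono a n m : (forall k, 0 <= a k) -> (n <= m)%nat -> psum a n <= psum a m.
Proof. intros h. induction 1; simpl; [lra|]. specialize (h m). lra. Qed.

Lemma pprod_pos a x n : (forall k, 0 <= a k) -> 0 <= x -> 0 < pprod a x n.
Proof.
  intros h hx. induction n; simpl; [lra|]. apply Rmult_lt_0_compat; auto.
  specialize (h n). nra.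
Qed.

(** Two terms of the binomial expansion, matching the two Leibniz terms in [dprod]. *)
Lemma pow_add_ge (s v : R) (j : nat) : 0 <= s -> 0 <= v ->
  s ^ S j + INR (S j) * v * s ^ j <= (s + v) ^ S j.
Proof.
  intros hs hv. induction j as [|j IH]; [simpl; lra|].
  rewrite (S_INR (S j)).
  change ((s + v) ^ S (S j)) with ((s + v) * (s + v) ^ S j).
  apply Rle_trans with ((s + v) * (s ^ S j + INR (S j) * v * s ^ j)).
  - assert (p := pow_le s j hs). assert (q := pos_INR (S j)).
    assert (0 <= INR (S j) * (v * v) * s ^ j).
    { apply Rmult_le_pos; [|exact p]. apply Rmult_le_pos; nra. }
    change (s ^ S (S j)) with (s * (s * s ^ j)). change (s ^ S j) with (s * s ^ j). nra.
  - apply Rmult_le_compat_l; [lra|exact IH].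
Qed.

(** The j-th derivative sums, over ordered j-tuples of distinct indices, products of the
    corresponding -u_k with the remaining factors. The tuples contribute at most the j-th power of
    the sum of |u_k|, and restoring the missing factors 1 + |z| |u_k| >= 1 only enlarges the
    bound. *)
Lemma dprod_bound u j n z :
  Cmod (dprod u j n z) <= psum (fun k => Cmod (u k)) n ^ j * pprod (fun k => Cmod (u k)) (Cmod z) n.
Proof.
  set (a := fun k => Cmod (u k)).
  assert (ha : forall k, 0 <= a k) by (intros; apply Cmod_ge_0).
  assert (hz := Cmod_ge_0 z).
  revert j. induction n as [|n IH]; intros j.
  - destruct j; simpl; [rewrite Cmod_1|rewrite Cmod_0]; lra.
  - assert (f1 : Cmod (1 - u n * z) <= 1 + Cmod z * a n).
    { eapply Rle_trans; [apply Cmod_triangle|].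
      rewrite Cmod_opp, Cmod_mult, Cmod_1. unfold a. lra. }
    assert (p := pprod_pos a (Cmod z) n ha hz). assert (s := psum_ge_0 a n ha).
    assert (an := ha n).
    assert (g0 := Cmod_ge_0 (1 - u n * z)).
    assert (g1 := Cmod_ge_0 (dprod u j n z)).
    assert (M : Cmod (dprod u j n z * (1 - u n * z)) <=
        psum a n ^ j * pprod a (Cmod z) n * (1 + Cmod z * a n)).
    { rewrite Cmod_mult. apply Rmult_le_compat; auto. }
    destruct j as [|j]; cbn [dprod psum pprod].
    + replace (dprod u 0 n z * (1 - u n * z) - 0)%C with (dprod u 0 n z * (1 - u n * z))%C by ring.
      simpl in M |- *. lra.
    + eapply Rle_trans; [apply Cmod_triangle|].
      rewrite Cmod_opp, (Cmod_mult _ (dprod u j n z)), (Cmod_mult (INR (S j)) (u n)), Cmod_R.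
      rewrite Rabs_pos_eq by apply pos_INR.
      change (Cmod (u n)) with (a n).
      assert (i := IH j). assert (q := pos_INR (S j)).
      assert (M2 : INR (S j) * a n * Cmod (dprod u j n z) <=
        INR (S j) * a n * (psum a n ^ j * pprod a (Cmod z) n) * (1 + Cmod z * a n)).
      { apply Rle_trans with (INR (S j) * a n * (psum a n ^ j * pprod a (Cmod z) n)).
        - apply Rmult_le_compat_l; [apply Rmult_le_pos; auto|exact i].
        - rewrite <- (Rmult_1_r (INR (S j) * a n * (psum a n ^ j * pprod a (Cmod z) n))) at 1.
          apply Rmult_le_compat_l; [|nra].
          apply Rmult_le_pos; [apply Rmult_le_pos; auto|].
          apply Rmult_le_pos; [apply pow_le; auto|lra]. }
      assert (PA := pow_add_ge (psum a n) (a n) j s an).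
      apply Rle_trans with ((psum a n ^ S j + INR (S j) * a n * psum a n ^ j) *
         (pprod a (Cmod z) n * (1 + Cmod z * a n))); [lra|].
      apply Rmult_le_compat_r; [|exact PA].
      apply Rmult_le_pos; [lra|nra].
Qed.

(** Split at a [K] beyond which the sum of the [a k] is below [eps / 2]. The first [K] factors form
    a fixed polynomial, at most c exp(eps x / 2); the others contribute at most exp(eps x / 2) since
    1 + y <= exp(y). For [n < K] the product only has fewer factors, all at least 1. *)
Lemma pprod_growth a l : (forall k, 0 <= a k) ->
  (forall n, psum a n <= l) -> (forall eta, 0 < eta -> exists K, l - eta < psum a K) ->
  forall eps, 0 < eps -> exists c, 0 < c /\
    forall n x, 0 <= x -> pprod a x n <= c * exp (eps * x).
Proof.
  intros ha ub tail eps he.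
  assert (fin : forall K eta, 0 < eta -> exists c, 0 < c /\
    forall x, 0 <= x -> pprod a x K <= c * exp (eta * x)).
  { induction K as [|K IH]; intros eta heta.
    - exists 1. split; [lra|]. intros x hx. simpl.
      assert (e := exp_ineq1_le (eta * x)). nra.
    - destruct (IH (eta / 2)) as (c & hc & bc); [lra|].
      assert (q : 0 <= a K / (eta / 2)).
      { apply Rmult_le_pos; [apply ha|]. left. apply Rinv_0_lt_compat. lra. }
      exists (c * (1 + a K / (eta / 2))). split; [apply Rmult_lt_0_compat; lra|].
      intros x hx. simpl. specialize (bc x hx).
      replace (eta * x) with (eta / 2 * x + eta / 2 * x) by field. rewrite exp_plus.
      assert (e := exp_ineq1_le (eta / 2 * x)).
      assert (le2 : 1 + x * a K <= (1 + a K / (eta / 2)) * exp (eta / 2 * x)).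
      { apply Rle_trans with ((1 + a K / (eta / 2)) * (1 + eta / 2 * x)).
        - replace ((1 + a K / (eta / 2)) * (1 + eta / 2 * x)) with
            (1 + x * a K + (a K / (eta / 2) + eta / 2 * x)) by (field; lra). nra.
        - apply Rmult_le_compat_l; lra. }
      replace (c * (1 + a K / (eta / 2)) * (exp (eta / 2 * x) * exp (eta / 2 * x))) with
        ((c * exp (eta / 2 * x)) * ((1 + a K / (eta / 2)) * exp (eta / 2 * x))) by ring.
      assert (p := pprod_pos a x K ha hx). specialize (ha K).
      apply Rmult_le_compat; [lra|nra|exact bc|exact le2]. }
  destruct (tail (eps / 2)) as [K hK]; [lra|].
  destruct (fin K (eps / 2)) as (c & hc & bc); [lra|].
  exists c. split; [exact hc|]. intros n x hx.
  apply Rle_trans with (pprod a x K * exp (eps / 2 * x)).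
  - destruct (Nat.le_gt_cases K n) as [h|h].
    + apply Rle_trans with (pprod a x K * exp (x * (psum a n - psum a K))).
      * clear - ha hx h. induction h as [|n h IH].
        { replace (x * (psum a K - psum a K)) with 0 by ring. rewrite exp_0. lra. }
        simpl. replace (x * (psum a n + a n - psum a K)) with
          (x * (psum a n - psum a K) + x * a n) by ring.
        rewrite exp_plus, <- Rmult_assoc.
        assert (p := pprod_pos a x n ha hx). specialize (ha n).
        apply Rmult_le_compat; [lra|nra|exact IH|apply exp_ineq1_le].
      * apply Rmult_le_compat_l; [left; apply pprod_pos; auto|].
        specialize (ub n).
        assert (le3 : x * (psum a n - psum a K) <= eps / 2 * x) by nra.
        destruct le3 as [l3|l3]; [left; apply exp_increasing; exact l3|right; rewrite l3; auto].
    + apply Rle_trans with (pprod a x K * 1).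
      * rewrite Rmult_1_r. clear - ha hx h. induction h; simpl.
        -- assert (p := pprod_pos a x n ha hx). specialize (ha n).
           assert (0 <= x * a n) by (apply Rmult_le_pos; auto). nra.
        -- assert (p := pprod_pos a x m ha hx). specialize (ha m).
           assert (0 <= x * a m) by (apply Rmult_le_pos; auto). nra.
      * apply Rmult_le_compat_l; [left; apply pprod_pos; auto|].
        assert (e := exp_ineq1_le (eps / 2 * x)). nra.
  - replace (c * exp (eps * x)) with (c * exp (eps / 2 * x) * exp (eps / 2 * x)).
    + apply Rmult_le_compat_r; [left; apply exp_pos|auto].
    + rewrite Rmult_assoc, <- exp_plus. f_equal. f_equal. field.
Qed.

Lemma hol_continuous F F1 (z : C) : hol F F1 ->
  (forall R0, exists L, forall w, Cmod w <= R0 -> Cmod (F1 w) <= L) ->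
  continuous (fun w => Cmod (F w)) z.
Proof.
  intros H bd. destruct (bd (Cmod z + 2)) as [L hL].
  assert (L0 : 0 <= L).
  { apply Rle_trans with (Cmod (F1 z)); [apply Cmod_ge_0|apply hL; lra]. }
  apply filterlim_locally. intros eps.
  assert (pe := cond_pos eps).
  (* The bound 1 keeps [w] in the disc of radius [Cmod z + 2]. The 2 in the denominator covers the
     [sqrt 2] between the max-norm ball and [Cmod], and [L + 1] avoids dividing by zero. *)
  set (d := Rmin 1 (eps / (2 * (L + 1)))).
  assert (hd : 0 < d).
  { apply Rmin_pos; [lra|]. apply Rdiv_lt_0_compat; lra. }
  exists (mkposreal d hd).
  assert (close : forall w : C, ball z (mkposreal d hd) w -> Rabs (Cmod (F w) - Cmod (F z)) < eps);
    [|exact close].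
  intros w hw.
  apply C_NormedModule_mixin_compat2 in hw. simpl in hw.
  change (minus w z) with (w - z)%C in hw.
  assert (hs := sqrt2_lt_2).
  assert (hw2 : Cmod (w - z) < 2 * d) by nra.
  assert (d1 := Rmin_l 1 (eps / (2 * (L + 1)))).
  assert (d2 := Rmin_r 1 (eps / (2 * (L + 1)))). fold d in d1, d2.
  assert (T := Cmod_triangle (w - z) z). replace (w - z + z)%C with w in T by ring.
  assert (lip := hol_lipschitz F F1 (Cmod z + 2) L z w H hL ltac:(lra) ltac:(lra)).
  assert (small : L * Cmod (w - z) < eps).
  { apply Rle_lt_trans with (L * (2 * d)); [apply Rmult_le_compat_l; lra|].
    apply Rlt_le_trans with ((L + 1) * (2 * d)); [nra|].
    apply (Rmult_le_compat_l (2 * (L + 1))) in d2; [|lra].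
    replace (2 * (L + 1) * (eps / (2 * (L + 1)))) with (pos eps) in d2 by (field; lra). lra. }
  apply Rabs_def1.
  - assert (T1 := Cmod_triangle (F w - F z) (F z)).
    replace (F w - F z + F z)%C with (F w) in T1 by ring. lra.
  - assert (T1 := Cmod_triangle (F w) (- (F w - F z))). rewrite Cmod_opp in T1.
    replace (F w + - (F w - F z))%C with (F z) in T1 by ring. lra.
Qed.

Lemma psum_sup a : (forall k, 0 <= a k) -> ex_series a -> exists l,
  (forall n, psum a n <= l) /\ forall eta, 0 < eta -> exists K, l - eta < psum a K.
Proof.
  intros ha [l hl]. exists l.
  assert (e : forall n, sum_n a n = psum a (S n)).
  { induction n as [|n IH]; [rewrite sum_O; simpl; ring|].
    rewrite sum_Sn, IH. reflexivity. }
  assert (lim : is_lim_seq (sum_n a) l) by exact hl.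
  split.
  - intros n. apply Rle_trans with (psum a (S n)); [simpl; specialize (ha n); lra|].
    rewrite <- e. apply (is_lim_seq_incr_compare (sum_n a)); [exact lim|].
    intros k. rewrite !e. apply psum_mono; [exact ha|lia].
  - intros eta he. apply is_lim_seq_spec in lim.
    destruct (lim (mkposreal eta he)) as [N hN]. exists (S N). rewrite <- e.
    specialize (hN N (Nat.le_refl N)). apply Rabs_def2 in hN. simpl in hN. lra.
Qed.

Lemma dprod_growth u l eps :
  (forall n, psum (fun k => Cmod (u k)) n <= l) ->
  (forall eta, 0 < eta -> exists K, l - eta < psum (fun k => Cmod (u k)) K) ->
  0 < eps -> exists c, 0 < c /\
    forall j n z, Cmod (dprod u j n z) <= l ^ j * (c * exp (eps * Cmod z)).
Proof.
  intros ub tail he.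
  assert (ha : forall k, 0 <= Cmod (u k)) by (intros; apply Cmod_ge_0).
  destruct (pprod_growth _ l ha ub tail eps he) as (c & hc & bc).
  exists c. split; [exact hc|]. intros j n z.
  eapply Rle_trans; [apply dprod_bound|].
  assert (p0 := psum_ge_0 _ n ha). assert (z0 := Cmod_ge_0 z).
  apply Rmult_le_compat; [apply pow_le; exact p0|left; apply pprod_pos; auto| |auto].
  apply pow_incr. auto.
Qed.

(** * Lower bounds for the partial products and their derivatives *)

(** Past an index [K] where |z| times the remaining sum of |u_k| is at most 1/2, prod (1 - |z|
    |u_k|) >= 1 - |z| sum |u_k| >= 1/2, so |g n| >= |g K| / 2; finitely many non-zero values remain.
    The recurrence form covers both P_n off the poles and P_n' at a pole. *)
Lemma factors_lower_bound u l (z : C) (m : nat) (g : nat -> C) :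
  (forall n, psum (fun k => Cmod (u k)) n <= l) ->
  (forall eta, 0 < eta -> exists K, l - eta < psum (fun k => Cmod (u k)) K) ->
  (forall n, (m <= n)%nat -> g (S n) = (g n * (1 - u n * z))%C) ->
  (forall n, (m <= n)%nat -> (1 - u n * z)%C <> RtoC 0) -> g m <> RtoC 0 ->
  exists c, 0 < c /\ forall n, (m <= n)%nat -> c <= Cmod (g n).
Proof.
  set (a := fun k => Cmod (u k)). intros ub tail rec nz gm.
  assert (ha : forall k, 0 <= a k) by (intros; apply Cmod_ge_0).
  assert (gn : forall n, (m <= n)%nat -> 0 < Cmod (g n)).
  { induction 1 as [|n h IH]; [apply Cmod_gt_0; exact gm|].
    rewrite rec, Cmod_mult by exact h. apply Rmult_lt_0_compat; [exact IH|].
    apply Cmod_gt_0. auto. }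
  assert (fin : forall k, exists c, 0 < c /\ forall n, (m <= n < m + k)%nat -> c <= Cmod (g n)).
  { induction k as [|k (c & hc & bc)]; [exists 1; split; [lra|intros; lia]|].
    exists (Rmin c (Cmod (g (m + k)%nat))). split; [apply Rmin_pos; auto; apply gn; lia|].
    intros n hn. destruct (Nat.eq_dec n (m + k)) as [->|ne]; [apply Rmin_r|].
    eapply Rle_trans; [apply Rmin_l|]. apply bc. lia. }
  assert (z0 := Cmod_ge_0 z).
  destruct (tail (/ (2 * (Cmod z + 1)))) as [K0 hK0]; [apply Rinv_0_lt_compat; lra|].
  set (K := (m + K0)%nat).
  destruct (fin K0) as (c & hc & bc).
  assert (gK := gn K ltac:(unfold K; lia)).
  exists (Rmin c (Cmod (g K) / 2)). split; [apply Rmin_pos; lra|].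
  intros n hn. destruct (Nat.lt_ge_cases n K) as [h|h].
  { eapply Rle_trans; [apply Rmin_l|]. apply bc. unfold K in h. lia. }
  eapply Rle_trans; [apply Rmin_r|].
  assert (half : forall n, Cmod z * (psum a n - psum a K) <= / 2).
  { intros k. specialize (ub k). fold a in ub.
    assert (mK := psum_mono a K0 K ha ltac:(unfold K; lia)).
    fold a in hK0.
    apply Rle_trans with (Cmod z * / (2 * (Cmod z + 1))).
    - apply Rmult_le_compat_l; [exact z0|lra].
    - rewrite <- Rdiv_def. apply Rle_div_l; lra. }
  assert (low : Cmod (g K) * (1 - Cmod z * (psum a n - psum a K)) <= Cmod (g n)).
  { induction h as [|n h IH]; [right; ring|].
    specialize (IH ltac:(unfold K in h; lia)).
    rewrite rec, Cmod_mult by (unfold K in h; lia).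
    assert (hf : 1 - Cmod z * a n <= Cmod (1 - u n * z)).
    { assert (T := Cmod_triangle (1 - u n * z) (u n * z)).
      replace (1 - u n * z + u n * z)%C with (RtoC 1) in T by ring.
      rewrite Cmod_1, Cmod_mult in T. unfold a. lra. }
    assert (h1 := half n). assert (h2 := half (S n)). simpl in h2 |- *.
    assert (an := ha n).
    assert (mn := psum_mono a K n ha h).
    set (X := Cmod z * (psum a n - psum a K)) in *. set (y := Cmod z * a n) in *.
    assert (X0 : 0 <= X) by (apply Rmult_le_pos; lra).
    assert (y0 : 0 <= y) by (apply Rmult_le_pos; lra).
    replace (Cmod z * (psum a n + a n - psum a K)) with (X + y) in * by (unfold X, y; ring).
    apply Rle_trans with (Cmod (g K) * (1 - X) * (1 - y)).
    - rewrite Rmult_assoc. apply Rmult_le_compat_l; [lra|]. nra.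
    - apply Rmult_le_compat; [|lra|exact IH|exact hf].
      apply Rmult_le_pos; lra. }
  specialize (half n). nra.
Qed.

Lemma factor_eq (t z : C) : t <> RtoC 0 -> (1 - / t * z)%C = (/ t * (t - z))%C.
Proof. intros h. field. exact h. Qed.

Lemma factor_nonzero (t z : C) : t <> RtoC 0 -> z <> t -> (1 - / t * z)%C <> RtoC 0.
Proof.
  intros h ne e. apply ne. rewrite factor_eq in e by exact h.
  replace z with (t - t * (/ t * (t - z)))%C by (field; exact h). rewrite e. ring.
Qed.

Lemma dprod_root (t : nat -> C) (j n : nat) : t j <> RtoC 0 -> (j < n)%nat ->
  dprod (fun k => / t k)%C 0 n (t j) = RtoC 0.
Proof.
  intros h. induction 1 as [|n hn IH]; cbn [dprod].
  - replace (1 - / t j * t j)%C with (RtoC 0) by (field; exact h). ring.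
  - rewrite IH. ring.
Qed.

Lemma dprod_nonzero (t : nat -> C) (n : nat) (z : C) : (forall k, t k <> RtoC 0) ->
  (forall k, (k < n)%nat -> z <> t k) -> dprod (fun k => / t k)%C 0 n z <> RtoC 0.
Proof.
  intros h. induction n as [|n IH]; intros hz.
  - intros e. apply (f_equal fst) in e. simpl in e. lra.
  - cbn [dprod]. replace (dprod (fun k => / t k)%C 0 n z * (1 - / t n * z) - 0)%C with
      (dprod (fun k => / t k)%C 0 n z * (1 - / t n * z))%C by ring.
    apply Cmult_neq_0; [apply IH; intros; apply hz; lia|].
    apply factor_nonzero; [apply h|apply hz; lia].
Qed.

(** The factor 1 - z / t_k has logarithmic derivative 1 / (z - t_k). The product has [S n] factors
    because [sum_n] up to [n] has [n + 1] terms. *)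
Lemma dprod_logderiv (t : nat -> C) (n : nat) (z : C) : (forall k, t k <> RtoC 0) ->
  (forall k, z <> t k) -> dprod (fun k => / t k)%C 1 (S n) z =
  (dprod (fun k => / t k)%C 0 (S n) z * sum_n (fun k => / (z - t k))%C n)%C.
Proof.
  intros h hz.
  assert (hz' : forall k, (z - t k)%C <> RtoC 0).
  { intros k e. apply (hz k). replace z with (z - t k + t k)%C by ring. rewrite e. ring. }
  induction n as [|n IH].
  - rewrite sum_O. cbn [dprod]. simpl. field. split; auto.
  - rewrite sum_Sn. change (plus ?x ?y) with (x + y)%C.
    change (dprod (fun k => / t k)%C 1 (S (S n)) z) with
      (dprod (fun k => / t k)%C 1 (S n) z * (1 - / t (S n) * z)
        - 1 * / t (S n) * dprod (fun k => / t k)%C 0 (S n) z)%C.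
    change (dprod (fun k => / t k)%C 0 (S (S n)) z) with
      (dprod (fun k => / t k)%C 0 (S n) z * (1 - / t (S n) * z) - 0)%C.
    rewrite IH. generalize (dprod (fun k => / t k)%C 0 (S n) z). intros p.
    change (plus ?x ?y) with (x + y)%C.
    generalize (sum_n (fun k => / (z - t k))%C n). intros s.
    specialize (h (S n)). specialize (hz' (S n)).
    field. split; auto.
Qed.

(** Once |t_k| > 2 |z|, |z - t_k| >= |t_k| / 2, so the tail is dominated by 2 / |t_k|. *)
Lemma pole_series_converges (t : nat -> C) (z : C) :
  is_lim_seq (fun n => Cmod (t n)) p_infty -> (forall k, t k <> RtoC 0) ->
  ex_series (fun n => (1 / Cmod (t n))%R) ->
  exists w, csum (fun k => / (z - t k))%C w.
Proof.
  intros lim h hs.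
  apply is_lim_seq_spec in lim. destruct (lim (2 * Cmod z)) as [N hN].
  apply (ex_series_incr_n (K:=C_AbsRing) (V:=C_NormedModule)) with (n := N).
  apply (ex_series_le (K:=C_AbsRing) (V:=C_CompleteNormedModule)) with
    (b := fun k => 2 * (1 / Cmod (t (N + k)%nat))).
  - intros k. change (Cmod (/ (z - t (N + k)%nat))%C <= 2 * (1 / Cmod (t (N + k)%nat))).
    assert (hk := hN (N + k)%nat ltac:(lia)). cbv beta in hk.
    set (w := t (N + k)%nat) in *.
    assert (z0 := Cmod_ge_0 z).
    assert (T := Cmod_triangle z (- (z - w))). rewrite Cmod_opp in T.
    replace (z + - (z - w))%C with w in T by ring.
    assert (hp : 0 < Cmod (z - w)) by lra.
    rewrite Cmod_inv by (apply Cmod_gt_0; exact hp).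
    replace (2 * (1 / Cmod w)) with (/ (Cmod w / 2)) by (field; lra).
    apply Rinv_le_contravar; lra.
  - apply (ex_series_scal (K:=R_AbsRing) (V:=R_NormedModule) 2 (fun k => 1 / Cmod (t (N + k)%nat))).
    apply (ex_series_incr_n (K:=R_AbsRing) (V:=R_NormedModule) (fun n => 1 / Cmod (t n)) N).
    exact hs.
Qed.

(** At a pole t_j, P_n(t_j) = 0 for n > j, so P_n'(t_j) obeys the recurrence of a plain product. Off
    the poles, P_n' is P_n times a partial sum of f(z): the former is bounded below and the latter
    tends to f(z), which is non-zero. *)
Lemma deriv_lower_bound (t : nat -> C) (z : C) :
  (forall m n : nat, m <> n -> t m <> t n) ->
  is_lim_seq (fun n => Cmod (t n)) p_infty -> (forall k, t k <> RtoC 0) ->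
  ex_series (fun n => (1 / Cmod (t n))%R) -> ~ pole_sum t z (RtoC 0) ->
  exists d N, 0 < d /\
    forall n, (N <= n)%nat -> d <= Cmod (dprod (fun k => / t k)%C 1 n z).
Proof.
  intros dist lim h hs nz. set (u := fun k => (/ t k)%C).
  assert (hu : ex_series (fun k => Cmod (u k))).
  { apply ex_series_ext with (2 := hs). intros n. unfold u. rewrite Cmod_inv by apply h.
    apply Rmult_1_l. }
  destruct (psum_sup _ (fun k => Cmod_ge_0 (u k)) hu) as (l & ub & tail).
  destruct (classic (exists j, z = t j)) as [[j ->]|np].
  - assert (hj : forall k, k <> j -> t j <> t k) by (intros k hk; apply dist; auto).
    destruct (factors_lower_bound u l (t j) (S j) (fun n => dprod u 1 n (t j)) ub tail)
      as (c & hc & bc).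
    { intros n hn. cbn [dprod]. unfold u at 4.
      rewrite (dprod_root t j n (h j)) by lia. ring. }
    { intros n hn. apply factor_nonzero; [apply h|apply hj; lia]. }
    (* P_(j+1)'(t_j) = - P_j(t_j) / t_j, which is non-zero as the t_k are distinct. *)
    { cbn [dprod]. unfold u at 2.
      replace (1 - / t j * t j)%C with (RtoC 0) by (field; apply h).
      assert (p := dprod_nonzero t j (t j) h ltac:(intros; apply hj; lia)).
      fold u in p. intros e. apply p.
      transitivity (- t j * (dprod u 1 j (t j) * 0 - INR 1 * u j * dprod u 0 j (t j)))%C;
        [change (u j) with (/ t j)%C; simpl; field; apply h|rewrite e; ring]. }
    exists c, (S j). split; assumption.
  - assert (hz : forall k, z <> t k) by (intros k e; apply np; exists k; exact e).
    destruct (pole_series_converges t z lim h hs) as [w hw].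
    assert (w0 : w <> RtoC 0) by (intros ->; apply nz; split; assumption).
    apply Cmod_gt_0 in w0.
    destruct (factors_lower_bound u l z 0 (fun n => dprod u 0 n z) ub tail) as (c & hc & bc).
    { intros n _. cbn [dprod]. ring. }
    { intros n _. apply factor_nonzero; [apply h|apply hz]. }
    { apply (dprod_nonzero t 0 z h). intros; apply hz. }
    (* With [Cmod w / 4], the max-norm ball still gives |s - w| < |w| / 2. *)
    assert (he : 0 < Cmod w / 4) by lra.
    destruct (proj1 (filterlim_locally _ _) hw (mkposreal _ he)) as [N hN].
    exists (c * (Cmod w / 2)), (S N). split; [apply Rmult_lt_0_compat; lra|].
    intros [|n] hn; [lia|].
    unfold u. rewrite dprod_logderiv by assumption. rewrite Cmod_mult.
    apply Rmult_le_compat; [lra|lra|apply (bc (S n)); lia|].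
    specialize (hN n ltac:(lia)). apply C_NormedModule_mixin_compat2 in hN.
    set (s := sum_n (fun k => / (z - t k))%C n) in *.
    change (Cmod (s - w) < sqrt 2 * (Cmod w / 4)) in hN.
    assert (hsq := sqrt2_lt_2).
    assert (T := Cmod_triangle s (- (s - w))). rewrite Cmod_opp in T.
    replace (s + - (s - w))%C with w in T by ring. nra.
Qed.

(** The pointwise bound spreads to neighbourhoods because the P_n' share a Lipschitz constant on the
    disc; [disc_compact] concludes. Letting [d] be the lower bound and [/ d] the threshold for [n]
    gives a property monotone in one parameter. *)
Lemma deriv_uniform_lower_bound (t : nat -> C) (R0 : R) :
  (forall m n : nat, m <> n -> t m <> t n) ->
  is_lim_seq (fun n => Cmod (t n)) p_infty -> (forall k, t k <> RtoC 0) ->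
  ex_series (fun n => (1 / Cmod (t n))%R) -> (forall z, ~ pole_sum t z (RtoC 0)) ->
  exists d, 0 < d /\ forall w, Cmod w <= R0 ->
    forall n, / d <= INR n -> d <= Cmod (dprod (fun k => / t k)%C 1 n w).
Proof.
  intros dist lim h hs nz. set (u := fun k => (/ t k)%C).
  assert (hu : ex_series (fun k => Cmod (u k))).
  { apply ex_series_ext with (2 := hs). intros n. unfold u. rewrite Cmod_inv by apply h.
    apply Rmult_1_l. }
  destruct (psum_sup _ (fun k => Cmod_ge_0 (u k)) hu) as (l & ub & tail).
  destruct (dprod_growth u l 1 ub tail Rlt_0_1) as (c & hc & bc).
  apply (disc_compact R0 (fun d w => forall n, / d <= INR n -> d <= Cmod (dprod u 1 n w))).
  { intros d e w hde H n hn. apply Rle_trans with e; [lra|]. apply H.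
    apply Rle_trans with (2 := hn). apply Rinv_le_contravar; lra. }
  intros z hz.
  destruct (deriv_lower_bound t z dist lim h hs (nz z)) as (d & N & hd & hN).
  fold u in hN.
  set (L := l ^ 2 * (c * exp (1 * R0)) + 1).
  assert (l0 := pow2_ge_0 l). assert (E := exp_pos (1 * R0)).
  assert (ce := Rmult_lt_0_compat _ _ hc E).
  assert (L1 : 1 <= L) by (unfold L; nra).
  assert (lip : forall n w, Cmod w <= R0 -> Cmod (dprod u 2 n w) <= L).
  { intros n w hw. eapply Rle_trans; [apply bc|]. unfold L.
    apply Rle_trans with (l ^ 2 * (c * exp (1 * R0))); [|lra].
    apply Rmult_le_compat_l; [exact l0|]. apply Rmult_le_compat_l; [lra|].
    destruct hw as [hw|hw]; [left; apply exp_increasing; lra|right; rewrite hw; auto]. }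
  assert (q := pos_INR N).
  (* Moving by less than [d / (2 * L)] costs at most [d / 2], and the remaining [d / 2] is at least
     [d / (2 * L)] as [L >= 1]. The other entry forces [n >= N]. *)
  exists (Rmin (d / (2 * L)) (/ (INR N + 1))). split.
  { apply Rmin_pos; [apply Rdiv_lt_0_compat; lra|apply Rinv_0_lt_compat; lra]. }
  intros w hw hwz n hn.
  set (e := Rmin (d / (2 * L)) (/ (INR N + 1))) in *.
  assert (e1 : e <= d / (2 * L)) by apply Rmin_l.
  assert (e2 : e <= / (INR N + 1)) by apply Rmin_r.
  assert (e0 : 0 < e).
  { apply Rmin_pos; [apply Rdiv_lt_0_compat; lra|apply Rinv_0_lt_compat; lra]. }
  assert (hn' : (N <= n)%nat).
  { apply INR_le. apply Rinv_le_contravar in e2; [|exact e0]. rewrite Rinv_inv in e2. lra. }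
  specialize (hN n hn').
  assert (lp := hol_lipschitz _ _ R0 L w z (hol_dprod u n 1) (lip n) hw hz).
  assert (sym : Cmod (z - w) = Cmod (w - z)).
  { rewrite <- Cmod_opp. f_equal. ring. }
  rewrite sym in lp.
  assert (T := Cmod_triangle (dprod u 1 n z - dprod u 1 n w) (dprod u 1 n w)).
  replace (dprod u 1 n z - dprod u 1 n w + dprod u 1 n w)%C with (dprod u 1 n z) in T by ring.
  apply (Rmult_le_compat_r (2 * L)) in e1; [|lra].
  replace (d / (2 * L) * (2 * L)) with d in e1 by (field; lra).
  nra.
Qed.

(** * The contradiction from two roots of a nearly affine function *)

Theorem theorem10 (t : nat -> C) (s : C)
  (t_distinct : forall m n : nat, m <> n -> t m <> t n)
  (t_infty : is_lim_seq (fun n : nat => Cmod (t n)) p_infty)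
  (t_nonzero : forall n : nat, t n <> RtoC 0)
  (t_summable : ex_series (fun n : nat => (1 / Cmod (t n))%R))
  (sum_inv_t : csum (fun n : nat => / t n)%C s)
  (s_nonzero : s <> RtoC 0) :
  exists z : C, pole_sum t z (RtoC 0).
Proof.
  apply NNPP. intros no.
  assert (nz : forall z, ~ pole_sum t z (RtoC 0)) by (intros z hz; apply no; exists z; exact hz).
  set (u := fun k => (/ t k)%C).
  assert (hu : ex_series (fun k => Cmod (u k))).
  { apply ex_series_ext with (2 := t_summable). intros n. unfold u.
    rewrite Cmod_inv by apply t_nonzero. apply Rmult_1_l. }
  destruct (psum_sup _ (fun k => Cmod_ge_0 (u k)) hu) as (l & ub & tail).
  assert (l0 : 0 <= l) by exact (ub 0%nat).
  assert (low := fun R0 => deriv_uniform_lower_bound t R0 t_distinct t_infty t_nonzero t_summable nz).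
  fold u in low.
  assert (exp_mono : forall x y, x <= y -> exp x <= exp y).
  { intros x y [hxy|hxy]; [left; apply exp_increasing; exact hxy|right; rewrite hxy; auto]. }
  (* A disc containing 0 and the roots t_0 and t_1. Next, [d] bounds |P_n'| below on it for large
     [n], and [K] bounds it above for all [n]. *)
  set (r := Cmod (t 0%nat) + Cmod (t 1%nat) + 1).
  assert (t0 := Cmod_ge_0 (t 0%nat)). assert (t1 := Cmod_ge_0 (t 1%nat)).
  assert (r0 : 0 < r) by (unfold r; lra).
  destruct (low r) as (d & hd & bd).
  destruct (dprod_growth u l 1 ub tail Rlt_0_1) as (c1 & hc1 & bc1).
  set (K := l * (c1 * exp (1 * r)) + 1).
  assert (K0 : 0 < K).
  { assert (p := Rmult_lt_0_compat _ _ hc1 (exp_pos (1 * r))). unfold K. nra. }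
  (* Chosen so that the Ahlfors-Schwarz bound, 4 K eps R0^2 = d R0^2 / (4 r) against |P_n''| (3/4)
     R0^2, yields |P_n''| <= d / (2 r). *)
  set (eps := d / (16 * K * r)).
  assert (he : 0 < eps).
  { apply Rdiv_lt_0_compat; [exact hd|]. repeat apply Rmult_lt_0_compat; lra. }
  destruct (dprod_growth u l eps ub tail he) as (c & hc & bc).
  (* [A] collects the constants in B - ln |P_n'|. The term [A / eps] of [R0] makes them at most
     [eps * R0], and [2 * r] gives R0^2 - |w|^2 >= (3/4) R0^2 for |w| <= r. *)
  set (A := Rabs (ln (l * c + 1) + 1 - ln d)).
  set (R0 := 2 * r + A / eps).
  assert (A0 : 0 <= A / eps).
  { apply Rmult_le_pos; [apply Rabs_pos|left; apply Rinv_0_lt_compat; exact he]. }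
  assert (AR : A <= eps * R0).
  { unfold R0. replace (eps * (2 * r + A / eps)) with (eps * (2 * r) + A) by (field; lra). nra. }
  (* The final 1 makes the bound on ln |P_n'| strict; the 1 inside the logarithm keeps its argument
     positive. *)
  set (B := ln (l * c + 1) + eps * R0 + 1).
  destruct (low R0) as (dR & hdR & bdR).
  (* [n] is fixed last, past the thresholds for both discs and at least 2, so that t_0 and t_1 are
     roots of P_n. *)
  destruct (INR_unbounded (/ d + / dR + 2)) as [n hn].
  assert (i1 := Rinv_0_lt_compat _ hd). assert (i2 := Rinv_0_lt_compat _ hdR).
  assert (cont : forall j z, continuous (fun w => Cmod (dprod u j n w)) z).
  { intros j z. apply (hol_continuous _ _ z (hol_dprod u n j)).
    intros R1. exists (l ^ S j * (c1 * exp (1 * R1))). intros w hw.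
    eapply Rle_trans; [apply bc1|]. apply Rmult_le_compat_l; [apply pow_le; exact l0|].
    apply Rmult_le_compat_l; [lra|]. apply exp_mono. lra. }
  assert (n0 : / d <= INR n) by lra. assert (n1 : / dR <= INR n) by lra.
  assert (bounded : forall w, Cmod w <= R0 ->
    dprod u 1 n w <> RtoC 0 /\ ln (Cmod (dprod u 1 n w)) < B).
  { intros w hw. specialize (bdR w hw n n1).
    split; [apply Cmod_gt_0; lra|].
    apply Rle_lt_trans with (ln ((l * c + 1) * exp (eps * R0))).
    - apply ln_le; [lra|]. eapply Rle_trans; [apply bc|]. rewrite pow_1.
      assert (em := exp_mono (eps * Cmod w) (eps * R0) ltac:(nra)).
      assert (ep := exp_pos (eps * R0)).
      assert (lc := Rmult_le_pos _ _ l0 (Rlt_le _ _ hc)).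
      apply Rle_trans with (l * c * exp (eps * R0)); [|lra].
      rewrite <- Rmult_assoc. apply Rmult_le_compat_l; assumption.
    - assert (lc := Rmult_le_pos _ _ l0 (Rlt_le _ _ hc)).
      rewrite ln_mult, ln_exp; [unfold B; lra|lra|apply exp_pos]. }
  assert (second : forall w, Cmod w <= r -> Cmod (dprod u 2 n w) <= d / (2 * r)).
  { intros w hw.
    assert (hwR : Cmod w <= R0) by (unfold R0; lra).
    assert (LB : ln d <= ln (Cmod (dprod u 1 n w))) by (apply ln_le; [exact hd|apply bd; auto]).
    assert (LD := log_deriv_bound (dprod u 1 n) (dprod u 2 n) (dprod u 3 n) (dprod u 4 n)
      R0 B ltac:(unfold R0; lra) (hol_dprod u n 1) (hol_dprod u n 2) (hol_dprod u n 3)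
      (cont 1%nat) (cont 2%nat) bounded w hwR).
    assert (Bd : B - ln (Cmod (dprod u 1 n w)) <= 2 * eps * R0).
    { assert (aa := Rle_abs (ln (l * c + 1) + 1 - ln d)). fold A in aa. unfold B. lra. }
    assert (B0 := proj2 (bounded w hwR)).
    assert (up : Cmod (dprod u 1 n w) <= K).
    { eapply Rle_trans; [apply bc1|]. unfold K. rewrite pow_1.
      apply Rle_trans with (l * (c1 * exp (1 * r))); [|lra].
      apply Rmult_le_compat_l; [exact l0|]. apply Rmult_le_compat_l; [lra|].
      apply exp_mono. lra. }
    assert (prod := Rmult_le_compat _ _ _ _ (Cmod_ge_0 (dprod u 1 n w))
                      (Rlt_le _ _ (proj2 (Rlt_0_minus _ _) B0)) up Bd).
    assert (R0r : 2 * r <= R0) by (unfold R0; lra).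
    assert (w0 := Cmod_ge_0 w). assert (y0 := Cmod_ge_0 (dprod u 2 n w)).
    assert (gap : 3 / 4 * R0 ^ 2 <= R0 ^ 2 - Cmod w ^ 2) by nra.
    assert (sq : 0 < R0 ^ 2) by (apply pow_lt; lra).
    apply (Rmult_le_compat_l _ _ _ y0) in gap.
    apply (Rmult_le_compat_l (2 * R0)) in prod; [|lra].
    apply Rmult_le_reg_r with (3 / 4 * R0 ^ 2); [lra|].
    apply Rle_trans with (2 * R0 * (K * (2 * eps * R0))); [lra|].
    replace (2 * R0 * (K * (2 * eps * R0))) with (d / r * (R0 ^ 2 / 4))
      by (unfold eps; field; lra).
    replace (d / (2 * r) * (3 / 4 * R0 ^ 2)) with (d / r * (R0 ^ 2 * (3 / 8)))
      by (field; lra).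
    apply Rmult_le_compat_l; [left; apply Rdiv_lt_0_compat; assumption|lra]. }
  assert (first : forall w, Cmod w <= r ->
    Cmod (dprod u 1 n w - dprod u 1 n (RtoC 0)) <= d / 2).
  { intros w hw.
    assert (z0 : Cmod (RtoC 0) <= r) by (rewrite Cmod_0; lra).
    eapply Rle_trans;
      [exact (hol_lipschitz _ _ r _ _ _ (hol_dprod u n 1) second z0 hw)|].
    replace (w - 0)%C with w by ring.
    replace (d / 2) with (d / (2 * r) * r) by (field; lra).
    apply Rmult_le_compat_l; [left; apply Rdiv_lt_0_compat; lra|exact hw]. }
  set (p := dprod u 1 n (RtoC 0)) in *.
  assert (hp : d <= Cmod p) by (apply bd; [rewrite Cmod_0; lra|exact n0]).
  (* P_n(z) - P_n'(0) z has derivative at most d / 2 on the disc. Between the roots t_0 and t_1 this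
     gives |P_n'(0)| |t_1 - t_0| <= (d / 2) |t_1 - t_0|, while |P_n'(0)| >= d. *)
  assert (HG : hol (fun z => dprod u 0 n z + - p * z)%C (fun z => dprod u 1 n z - p)%C).
  { eapply hol_ext; [| |apply hol_plus;
      [apply (hol_dprod u n 0)|apply hol_mult; [apply (hol_const (- p))|apply hol_id]]].
    - intros z. reflexivity.
    - intros z. cbv beta. ring. }
  assert (n2 : (2 <= n)%nat) by (apply INR_le; simpl; lra).
  assert (lip := hol_lipschitz _ _ r _ (t 0%nat) (t 1%nat) HG first
    ltac:(unfold r; lra) ltac:(unfold r; lra)).
  cbv beta in lip. unfold u in lip. rewrite !dprod_root in lip by (auto; lia).
  replace (0 + - p * t 1%nat - (0 + - p * t 0%nat))%C with (- (p * (t 1%nat - t 0%nat)))%C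
    in lip by ring.
  rewrite Cmod_opp, Cmod_mult in lip.
  assert (gap : 0 < Cmod (t 1%nat - t 0%nat)).
  { apply Cmod_gt_0. intros e. apply (t_distinct 1%nat 0%nat); [lia|].
    replace (t 1%nat) with (t 1%nat - t 0%nat + t 0%nat)%C by ring. rewrite e. ring. }
  nra.
Qed.
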